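(* Let $\{\mathfrak F_n,\,n\ge0\}$ be a filtration on a probability space $(\Omega,\mathfrak F,\mathbb P)$ with $\mathfrak F_0$ trivial, and let $\{Z_n,\,n\ge1\}$ be a sequence of square integrable martingale differences: $Z_n$ is $\mathfrak F_n$-measurable, $\mathbb EZ_n^2<+\infty$ and $\mathbb E[Z_n|\mathfrak F_{n-1}]=0$ for all $n\ge1$. Let $M_0:=0$, $M_N:=\sum_{j=1}^NZ_j$, and $\langle M\rangle_N:=\sum_{j=1}^N\mathbb E[Z_j^2|\mathfrak F_{j-1}]$ for $N\ge1$, $\langle M\rangle_0:=0$. Assume: M1) for every $\varepsilon>0$, $\displaystyle\lim_{N\to+\infty}\frac1N\sum_{j=0}^{N-1}\mathbb E\big[Z_{j+1}^2,\,|Z_{j+1}|\ge\varepsilon\sqrt N\big]=0$; M2) $\sup_{n\ge1}\mathbb EZ_n^2<+\infty$, and there exists $\sigma\ge0$ such that $$\lim_{K\to\infty}\limsup_{\ell\to\infty}\frac1\ell\sum_{m=1}^\ell\mathbb E\Big|\frac1K\mathbb E\big[\langle M\rangle_{mK}-\langle M\rangle_{(m-1)K}\,\big|\,\mathfrak F_{(m-1)K}\big]-\sigma^2\Big|=0;$$ M3) for every $\varepsilon>0$, $$\lim_{K\to\infty}\limsup_{\ell\to\infty}\frac1{\ell K}\sum_{m=1}^\ell\sum_{j=(m-1)K}^{mK-1}\mathbb E\big[1+Z_{j+1}^2,\,|M_j-M_{(m-1)K}|\ge\varepsilon\sqrt{\ell K}\big]=0.$$ Then $$\lim_{N\to+\infty}\frac{\mathbb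 E\langle M\rangle_N}{N}=\sigma^2\qquad\text{and}\qquad\lim_{N\to\infty}\mathbb E\,e^{i\theta M_N/\sqrt N}=e^{-\sigma^2\theta^2/2},\quad\forall\,\theta\in\mathbb R.$$
   Context: $\mathbb E[Y,A]$ denotes $\mathbb E[Y1_A]$ for a random variable $Y$ and an event $A$. $K,\ell,N$ range over positive integers. *)

(* Defs.v *)
From mathcomp Require Import all_boot all_order all_algebra.
From mathcomp Require Import complex.
From mathcomp Require Import all_classical all_reals all_analysis.

Set Implicit Arguments.
Unset Strict Implicit.
Unset Printing Implicit Defensive.

Import Order.TTheory GRing.Theory Num.Theory.
Import numFieldNormedType.Exports.

Local Open Scope classical_set_scope.
Local Open Scope complex_scope.
Local Open Scope ring_scope.

Definition filtration (d : measure_display) (T : measurableType d)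
    (F : nat -> set (set T)) : Prop :=
  [/\ forall n, sigma_algebra [set: T] (F n),
      forall n, F n `<=` measurable
    & forall m n, (m <= n)%N -> F m `<=` F n].

Definition measurable_wrt (d : measure_display) (T : measurableType d)
    (R : realType) (G : set (set T)) (Y : T -> R) : Prop :=
  forall B : set R, measurable B -> G (Y @^-1` B).

(* [Y] is a version of the conditional expectation of [X] given the
   sub-sigma-algebra [G]; such a [Y] is determined up to [P]-null sets. *)
Definition is_cond_expectation (d : measure_display) (T : measurableType d)
    (R : realType) (P : probability T R) (G : set (set T)) (X Y : T -> R)
    : Prop :=
  [/\ P.-integrable [set: T] (EFin \o X),
      P.-integrable [set: T] (EFin \o Y),
      measurable_wrt G Y
    & forall A, G A ->
        (\int[P]_(w in A) (Y w)%:E = \int[P]_(w in A) (X w)%:E)%E].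

(* E[Y, A] = E[Y 1_A] *)
Definition expectation_on (d : measure_display) (T : measurableType d)
    (R : realType) (P : probability T R) (Y : T -> R) (A : set T) : \bar R :=
  'E_P[fun w => Y w * \1_A w].

(* Sequences are indexed from 1, as in M_N = Z_1 + ... + Z_N; the value at
   index 0 is never used. *)
Definition partial_sum (T : Type) (R : realType) (Y : nat -> T -> R)
    (N : nat) : T -> R :=
  fun w => \sum_(1 <= j < N.+1) Y j w.

(* e^{it} *)
Definition expi (R : realType) (t : R) : R[i] := cos t +i* sin t.

Definition complex_expectation (d : measure_display) (T : measurableType d)
    (R : realType) (P : probability T R) (f : T -> R[i]) : R[i] :=
  fine 'E_P[fun w => complex.Re (f w)] +i* fine 'E_P[fun w => complex.Im (f w)].

(* Main.v *)
(** Multiply [E cos(theta M_n / sqrt N + phi)] by [exp(sigma^2 theta^2 n / (2N))]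
and telescope in [n] from [0] to [N]. A second order Taylor expansion in the
increment [Z_(j+1)] leaves, by the martingale property and up to errors
controlled by M1, the sum over [j < N] of [E[Y_j (Z_(j+1)^2 - sigma^2)] / N],
with [Y_j] bounded, [F_j]-measurable and varying slowly with [j]. Cut this sum
into blocks of length [K]: M3 allows [Y_j] to be frozen at the beginning of its block, and
conditioning on the past of the block turns what remains into
[E|W_m / K - sigma^2|], which M2 controls. The choice [Y_j = 1] gives
the convergence of the mean bracket, the phases [phi = 0] and [phi = - pi / 2]
the real and imaginary parts of the characteristic function. *)
Require Import Defs.
From mathcomp Require Import all_boot all_order all_algebra.
From mathcomp Require Import complex.
From mathcomp Require Import all_classical all_reals all_analysis.
From mathcomp Require Import measurable_realfun.
From mathcomp Require Import ring lra zify.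

Set Implicit Arguments.
Unset Strict Implicit.
Unset Printing Implicit Defensive.

Import Order.TTheory GRing.Theory Num.Theory.
Import numFieldNormedType.Exports.

Local Open Scope classical_set_scope.
Local Open Scope complex_scope.
Local Open Scope ring_scope.

(** * Taylor bounds for sine and cosine *)

Section trigonometric_bounds.
Context {R : realType}.
Implicit Types x y u h : R.

Lemma MVT_cos x y : exists z, cos y - cos x = - sin z * (y - x).
Proof.
wlog xy : x y / x < y => [H|].
  have [/H//|/H[z zE]|->] := ltgtP x y.
    by exists z; rewrite -opprB zE; ring.
  by exists 0; rewrite !subrr mulr0.
have [z _ zE] := @MVT R (@cos R) (fun z => - sin z) x y xy
  (fun z _ => is_derive_cos z) (continuous_subspaceT (@continuous_cos R)).
by exists z.
Qed.

(** Mean value theorem for [z - sin z] on [[0, x]]; both sides are odd in [x], which removes the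
    sign restriction. It reduces the sine remainder to a bound on [1 - cos]. *)
Lemma MVT_subsin x : exists2 z, `|z| <= `|x| & x - sin x = x * (1 - cos z).
Proof.
wlog x0 : x / 0 < x => [H|].
  have [/H//|x0|<-] := ltgtP 0 x; last by exists 0; rewrite ?sin0 ?mul0r ?subrr.
  have [|z zx zE] := H (- x); first by rewrite oppr_gt0.
  exists z; first by rewrite normrN in zx.
  by rewrite sinN in zE; lra.
have df (z : R) : is_derive z 1 (fun z : R => z - sin z : R) (1 - cos z).
  exact: is_deriveB.
have [z z0x zE] := @MVT R (fun z => z - sin z) (fun z => 1 - cos z) 0 x x0
  (fun z _ => df z)
  (derivable_within_continuous (fun z _ => @ex_derive _ _ _ _ _ _ _ (df z))).
exists z; first by move: z0x; rewrite in_itv/= => /andP[? ?]; rewrite !ger0_norm; lra.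
by rewrite sin0 !subr0 in zE; rewrite zE mulrC.
Qed.

Lemma dist_cos_le x y : `|cos x - cos y| <= `|x - y|.
Proof.
have [z ->] := MVT_cos y x.
by rewrite normrM normrN ler_piMl// sin_max.
Qed.

(** [sin] is [cos] shifted by [pi / 2], so this is the Lipschitz bound of [cos] taken at one of its
    zeros. *)
Lemma norm_sin_le x : `|sin x| <= `|x|.
Proof.
have := dist_cos_le (x - pi / 2) (- (pi / 2)).
by rewrite cosBpihalf cosN cos_pihalf subr0 opprK subrK.
Qed.

Lemma subr1cosE x : 1 - cos x = 2 * sin (x / 2) ^+ 2.
Proof.
have -> : cos x = cos ((x / 2) *+ 2) by congr cos; lra.
rewrite cos_mulr2n cos2sin2; lra.
Qed.

Lemma subr1cos_le x : 0 <= 1 - cos x <= x ^+ 2 / 2.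
Proof.
rewrite subr_ge0 cos_le1 subr1cosE/=.
have : sin (x / 2) ^+ 2 <= (x / 2) ^+ 2.
  rewrite -[leLHS]real_normK ?num_real// -[leRHS]real_normK ?num_real//.
  by rewrite lerXn2r ?nnegrE// norm_sin_le.
by rewrite expr_div_n; lra.
Qed.

(** [MVT_subsin] with [1 - cos z <= z^2 / 2 <= x^2 / 2]. The constant is not the sharp 1/6; only the
    order matters below. *)
Lemma norm_subsin_le3 x : `|x - sin x| <= `|x| ^+ 3 / 2.
Proof.
have [z zx ->] := MVT_subsin x.
have /andP[c0 c1] := subr1cos_le z.
rewrite normrM (ger0_norm c0) exprS -mulrA ler_wpM2l//.
apply: (le_trans c1); rewrite ler_pM2r// -[z ^+ 2]real_normK ?num_real//.
by rewrite lerXn2r ?nnegrE.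
Qed.

Lemma norm_subsin_le x : `|x - sin x| <= 2 * `|x|.
Proof.
by rewrite (le_trans (ler_normB _ _))// mulrDl mul1r lerD2l norm_sin_le.
Qed.

(* Geometric mean of the two previous bounds. *)
Lemma norm_subsin_le2 x : `|x - sin x| <= `|x| ^+ 2.
Proof.
have H3 := norm_subsin_le3 x; have H1 := norm_subsin_le x.
rewrite -(@ler_pXn2r _ 2) ?nnegrE ?exprn_ge0//.
rewrite expr2 (le_trans (ler_pM _ _ H3 H1))//.
rewrite -exprM.
have -> : `|x| ^+ 3 / 2 * (2 * `|x|) = `|x| ^+ 3 * `|x| by field.
by rewrite -exprSr.
Qed.

Lemma cos_remainder_le2 x : `|cos x - 1 + x ^+ 2 / 2| <= x ^+ 2 / 2.
Proof. by have /andP[? ?] := subr1cos_le x; rewrite ger0_norm; lra. Qed.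

(** The half-angle formula makes this a difference of squares, [2 ((x/2)^2 - sin(x/2)^2)]: the
    factor with the minus sign is quadratically small, the other one linearly. *)
Lemma cos_remainder_le3 x : `|cos x - 1 + x ^+ 2 / 2| <= `|x| ^+ 3 / 2.
Proof.
have -> : cos x - 1 + x ^+ 2 / 2 = 2 * ((x / 2 - sin (x / 2)) * (x / 2 + sin (x / 2))).
  have -> : cos x - 1 = - (1 - cos x) by lra.
  by rewrite subr1cosE; field.
have H1 := norm_subsin_le2 (x / 2).
have H2 : `|x / 2 + sin (x / 2)| <= 2 * `|x / 2|.
  by rewrite (le_trans (ler_normD _ _))// mulrDl mul1r lerD2l norm_sin_le.
have := ler_pM (normr_ge0 _) (normr_ge0 _) H1 H2.
rewrite -normrM => H; rewrite normrM (ger0_norm (ler0n _ _)); move: H.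
have -> : `|x / 2| = `|x| / 2 by rewrite normrM (@ger0_norm _ 2^-1).
have -> : (`|x| / 2) ^+ 2 * (2 * (`|x| / 2)) = `|x| ^+ 3 / 4 by field.
lra.
Qed.

(** The addition formula moves the remainder at [u] to the remainders of [cos] and [sin] at 0. *)
Lemma cosD_remainderE u h : cos (u + h) - (cos u - h * sin u - h ^+ 2 / 2 * cos u) =
  cos u * (cos h - 1 + h ^+ 2 / 2) + sin u * (h - sin h).
Proof. by rewrite cosD; ring. Qed.

(** Meant for large increments, whose second moments are controlled by M1. *)
Lemma cosD_remainder_le2 u h :
  `|cos (u + h) - (cos u - h * sin u - h ^+ 2 / 2 * cos u)| <= 2 * h ^+ 2.
Proof.
rewrite cosD_remainderE (le_trans (ler_normD _ _))// !normrM.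
have := ler_piMl (normr_ge0 (cos h - 1 + h ^+ 2 / 2)) (cos_max u).
have := ler_piMl (normr_ge0 (h - sin h)) (sin_max u).
have := norm_subsin_le2 h; have := cos_remainder_le2 h; have := sqr_ge0 h.
rewrite real_normK ?num_real//; lra.
Qed.

(** Meant for small increments: one of the three factors [|h|] is bounded by the threshold, which
    leaves a second moment. *)
Lemma cosD_remainder_le3 u h :
  `|cos (u + h) - (cos u - h * sin u - h ^+ 2 / 2 * cos u)| <= `|h| ^+ 3.
Proof.
rewrite cosD_remainderE (le_trans (ler_normD _ _))// !normrM.
have := ler_piMl (normr_ge0 (cos h - 1 + h ^+ 2 / 2)) (cos_max u).
have := ler_piMl (normr_ge0 (h - sin h)) (sin_max u).
have := norm_subsin_le3 h; have := cos_remainder_le3 h; lra.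
Qed.

End trigonometric_bounds.

(** * Measurability with respect to a sub-sigma-algebra *)

(** Since [G] is already a sigma-algebra, generating from it adds no set; the closure properties of
    measurable functions thus carry over to [measurable_wrt]. *)
Lemma measurable_wrtP d (T : measurableType d) (R : realType) (G : set (set T))
    (Y : T -> R) : sigma_algebra [set: T] G ->
  measurable_wrt G Y <->
  measurable_fun [set: g_sigma_algebraType G] (Y : g_sigma_algebraType G -> R).
Proof.
move=> sG; split=> [H _ B mB|H B mB].
  by rewrite setTI; apply: sub_sigma_algebra; exact: H.
have := H measurableT B mB; rewrite setTI.
by rewrite /measurable/= sigma_algebra_id.
Qed.

Section measurable_wrt.
Context d (T : measurableType d) (R : realType) (G : set (set T)).
Context (sG : sigma_algebra [set: T] G).
Implicit Types X Y : T -> R.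

Lemma measurable_wrt_cst (r : R) : measurable_wrt G (fun=> r).
Proof. by apply/measurable_wrtP => //; exact: measurable_cst. Qed.

Lemma measurable_wrtD X Y : measurable_wrt G X -> measurable_wrt G Y ->
  measurable_wrt G (fun w => X w + Y w).
Proof.
move=> /measurable_wrtP mX /measurable_wrtP mY; apply/measurable_wrtP => //.
by apply: measurable_funD; [exact: mX|exact: mY].
Qed.

Lemma measurable_wrt_comp (f : R -> R) X : measurable_fun setT f ->
  measurable_wrt G X -> measurable_wrt G (fun w => f (X w)).
Proof.
move=> mf mX B mB; have := mf measurableT B mB; rewrite setTI => mfB.
exact: mX mfB.
Qed.

Lemma measurable_wrt_fun X : G `<=` measurable -> measurable_wrt G X ->
  measurable_fun setT X.
Proof. by move=> GT mX _ B mB; rewrite setTI; apply: GT; exact: mX. Qed.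

End measurable_wrt.

Lemma measurable_wrtS d (T : measurableType d) (R : realType)
    (G H : set (set T)) (X : T -> R) :
  G `<=` H -> measurable_wrt G X -> measurable_wrt H X.
Proof. by move=> GH mX B mB; apply: GH; exact: mX. Qed.

(** * Integrals of real functions under a probability *)

Section real_expectation.
Context d (T : measurableType d) (R : realType) (P : probability T R).
Implicit Types X Y : T -> R.

Lemma Rintegral_cst_prob (r : R) : \int[P]_(_ in [set: T]) r = r.
Proof.
rewrite (Rintegral_cst P measurableT) -[RHS]mulr1; congr (_ * _).
exact: (congr1 fine (@probability_setT _ _ _ P)).
Qed.

Lemma integrable_cst_prob (r : R) : P.-integrable setT (EFin \o (fun=> r)).
Proof. exact: finite_measure_integrable_cst. Qed.

Lemma integrableD_real X Y : P.-integrable setT (EFin \o X) ->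
  P.-integrable setT (EFin \o Y) ->
  P.-integrable setT (EFin \o (fun w => X w + Y w)).
Proof. by move=> iX iY; exact: (integrableD measurableT iX iY). Qed.

Lemma integrableB_real X Y : P.-integrable setT (EFin \o X) ->
  P.-integrable setT (EFin \o Y) ->
  P.-integrable setT (EFin \o (fun w => X w - Y w)).
Proof. by move=> iX iY; exact: (integrableB measurableT iX iY). Qed.

Lemma integrableZl_real (r : R) X : P.-integrable setT (EFin \o X) ->
  P.-integrable setT (EFin \o (fun w => r * X w)).
Proof. by move=> iX; exact: (integrableZl measurableT _ iX). Qed.

Lemma integrable_norm_real X : P.-integrable setT (EFin \o X) ->
  P.-integrable setT (EFin \o (fun w => `|X w|)).
Proof. by move=> iX; exact: (integrable_norm iX). Qed.

Lemma integrable_sum_real I (s : seq I) (Q : pred I) (X : I -> T -> R) :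
  (forall i, Q i -> P.-integrable setT (EFin \o X i)) ->
  P.-integrable setT (EFin \o (fun w => \sum_(i <- s | Q i) X i w)).
Proof.
move=> iX; have := integrable_sum measurableT s iX.
by congr (integrable _ _ _); apply/funext => w /=; rewrite sumEFin.
Qed.

Lemma integrableMl_real (B : R) X Y : measurable_fun setT Y ->
  (forall w, `|Y w| <= B) -> P.-integrable setT (EFin \o X) ->
  P.-integrable setT (EFin \o (fun w => Y w * X w)).
Proof.
move=> mY YB iX; apply: (integrableMr measurableT mY _ iX).
exists B; split; first exact: num_real.
by move=> M BM w _ /=; exact: (le_trans (YB w) (ltW BM)).
Qed.

Lemma integrable_mul_indic X (A : set T) : measurable A ->
  P.-integrable setT (EFin \o X) ->
  P.-integrable setT (EFin \o (fun w => X w * \1_A w)).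
Proof.
move=> mA iX; under eq_fun do rewrite mulrC.
apply: (@integrableMl_real 1) => //.
by move=> w; rewrite indicE; case: (_ \in _); rewrite ?normr1 ?normr0.
Qed.

Lemma le_integrable_real X Y : measurable_fun setT X ->
  (forall w, `|X w| <= Y w) -> P.-integrable setT (EFin \o Y) ->
  P.-integrable setT (EFin \o X).
Proof.
move=> mX XY; apply: le_integrable => //; first exact/measurable_EFinP.
by move=> w _ /=; rewrite lee_fin (le_trans (XY w))// ler_norm.
Qed.

Lemma Rintegral_sum I (s : seq I) (Q : pred I) (X : I -> T -> R) :
  (forall i, Q i -> P.-integrable setT (EFin \o X i)) ->
  \int[P]_w (\sum_(i <- s | Q i) X i w) = \sum_(i <- s | Q i) \int[P]_w X i w.
Proof.
move=> iX; elim: s => [|i s IH].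
  by under eq_Rintegral do rewrite big_nil; rewrite big_nil; exact: (Rintegral_cst_prob 0).
under eq_Rintegral do rewrite big_cons.
rewrite big_cons; case: (boolP (Q i)) => // Qi.
rewrite RintegralD ?IH//; first exact: iX.
exact: integrable_sum_real.
Qed.

Lemma Rintegral_indicM (A : set T) X : measurable A ->
  \int[P]_w (\1_A w * X w) = \int[P]_(w in A) X w.
Proof.
move=> mA; rewrite [RHS]Rintegral_mkcond; apply: eq_Rintegral => w _.
by rewrite patchE indicE; case: ifPn; rewrite ?mul1r ?mul0r.
Qed.

Lemma norm_Rintegral_le X Y : P.-integrable setT (EFin \o X) ->
  P.-integrable setT (EFin \o Y) -> (forall w, `|X w| <= Y w) ->
  `|\int[P]_w X w| <= \int[P]_w Y w.
Proof.
move=> iX iY XY; rewrite (le_trans (le_normr_Rintegral _ _))//.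
by apply: le_Rintegral => //; exact: integrable_norm_real.
Qed.

Lemma expectation_Rintegral X : P.-integrable setT (EFin \o X) ->
  'E_P[X]%E = (\int[P]_w X w)%:E.
Proof.
by move=> iX; rewrite unlock /Rintegral fineK//; exact: integrable_fin_num.
Qed.

End real_expectation.

(** * Conditional expectation tested against bounded weights *)

(** For [h > 0] the sum is the staircase [h * floor (v / h)]: each level [h * k.+1] not above [v]
    contributes one step [h]. *)
Lemma layer_cake_approx (R : realType) (h v : R) (m : nat) :
  0 <= h -> 0 <= v <= h * m%:R ->
  `|v - \sum_(0 <= k < m) h * (h * k.+1%:R <= v)%R%:R| <= h.
Proof.
move=> h0; elim: m v => [|m IH] v.
  by rewrite mulr0 big_nil => ?; rewrite ger0_norm; lra.
(* Below [h] no level is reached; otherwise the lowest one is, and removing it leaves [v - h] with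
   [m] levels. *)
move=> vm; have [vh|hv] := ltP v h.
  rewrite big1_seq => [|k _]; first by rewrite subr0 ger0_norm; lra.
  rewrite (_ : _ <= _ = false) ?mulr0//; apply/negbTE; rewrite -ltNge.
  by rewrite (lt_le_trans vh)// ler_peMr// ler1n.
rewrite big_nat_recl// mulr1 hv mulr1 opprD addrA.
rewrite (eq_bigr (fun k => h * (h * k.+1%:R <= v - h)%R%:R)) => [|k _].
  by apply: IH; move: vm; rewrite -natr1 mulrDr mulr1; lra.
by rewrite lerBrDr -[in LHS]natr1 mulrDr mulr1.
Qed.

Section conditional_expectation.
Context d (T : measurableType d) (R : realType) (P : probability T R).
Context (G : set (set T)).
Context (sG : sigma_algebra [set: T] G) (GT : G `<=` measurable).
Implicit Types X Y U D : T -> R.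

(** The hypothesis is the case of indicators. A bounded [U] is, up to a constant, a uniform limit of
    their combinations, and a step size [h] costs at most [h * E|D|]. *)
Lemma Rintegral_mulr_eq0 (B : R) U D : P.-integrable setT (EFin \o D) ->
  measurable_wrt G U -> (forall w, `|U w| <= B) ->
  (forall A, G A -> \int[P]_(w in A) D w = 0) -> \int[P]_w (U w * D w) = 0.
Proof.
move=> iD mU UB D0.
have B0 : 0 <= B := le_trans (normr_ge0 _) (UB point).
have mUT := measurable_wrt_fun GT mU.
have iUD := integrableMl_real mUT UB iD.
have D0T : \int[P]_w D w = 0.
  by apply: D0; case: sG => G0 GD _; rewrite -(setD0 [set: T]); exact: GD.
suff H (h : R) : 0 < h -> `|\int[P]_w (U w * D w)| <= h * \int[P]_w `|D w|.
  have I0 : 0 <= \int[P]_w `|D w| by exact: Rintegral_ge0.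
  apply/eqP; rewrite -normr_le0; apply/ler_addgt0Pr => e e0; rewrite add0r.
  (* The [+ 1] keeps the divisor positive when [D] vanishes almost surely. *)
  have I1 : 0 < \int[P]_w `|D w| + 1 by lra.
  apply: (le_trans (H (e / (\int[P]_w `|D w| + 1)) _)); first by rewrite divr_gt0.
  by rewrite mulrAC ler_pdivrMr// ler_wpM2l//; lra.
(* [V := U + B >= 0] is within [h] of a combination of the indicators of
   the sets [A k], which belong to [G]. *)
move=> h0; pose V w := U w + B.
(* Enough levels of height [h] to cover the range [[0, 2 B]] of [V]. *)
pose m := (Num.truncn (2 * B / h)).+1.
have Vm w : 0 <= V w <= h * m%:R.
  have := UB w; rewrite ler_norml /V => /andP[U1 U2]; apply/andP; split; first lra.
  have : 2 * B / h <= m%:R by rewrite ltW// truncnS_gt.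
  rewrite ler_pdivrMr// mulrC; lra.
pose A k := [set w | h * k.+1%:R <= V w].
have GA k : G (A k).
  have -> : A k = U @^-1` `[h * k.+1%:R - B, +oo[.
    by apply/seteqP; split => w /=; rewrite in_itv/= andbT lerBlDr.
  exact: mU.
have iAD k : P.-integrable setT (EFin \o (fun w => \1_(A k) w * D w)).
  apply: (@integrableMl_real _ _ _ _ 1) => //.
    by apply: measurable_indic; exact: GT.
  by move=> w; rewrite indicE; case: (_ \in _); rewrite ?normr1 ?normr0.
pose S w := \sum_(0 <= k < m) h * (\1_(A k) w * D w).
have iS : P.-integrable setT (EFin \o S).
  by apply: integrable_sum_real => k _; exact: integrableZl_real.
have S0 : \int[P]_w S w = 0.
  rewrite Rintegral_sum => [|k _]; last exact: integrableZl_real.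
  rewrite big1 // => k _; rewrite RintegralZl//.
  by rewrite Rintegral_indicM ?D0 ?mulr0//; exact: GT.
(* [B * D] and [S] both integrate to zero, so inserting them costs nothing and leaves [D] times the
   distance of [V] to its staircase. *)
have -> : \int[P]_w (U w * D w) = \int[P]_w (U w * D w + B * D w - S w).
  rewrite RintegralB//; last by apply: integrableD_real => //; exact: integrableZl_real.
  rewrite S0 subr0 RintegralD//; last exact: integrableZl_real.
  by rewrite RintegralZl// D0T mulr0 addr0.
rewrite -RintegralZl//; last exact: integrable_norm_real.
apply: norm_Rintegral_le.
- apply: integrableB_real => //; apply: integrableD_real => //.
  exact: integrableZl_real.
- by apply: integrableZl_real; exact: integrable_norm_real.
move=> w; rewrite -mulrDl -/(V w) /S.
under eq_bigr do rewrite mulrA.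
rewrite -mulr_suml -mulrBl normrM ler_wpM2r//.
apply: le_trans (layer_cake_approx (ltW h0) (Vm w)).
under eq_bigr do rewrite indicE mem_setE.
by [].
Qed.

(** Pull-out property in integrated form: [X - Y] integrates to zero over every set of [G]. *)
Lemma cond_expectation_mul (B : R) X Y U : is_cond_expectation P G X Y ->
  measurable_wrt G U -> (forall w, `|U w| <= B) ->
  \int[P]_w (U w * X w) = \int[P]_w (U w * Y w).
Proof.
move=> [iX iY mY XY] mU UB; have mUT := measurable_wrt_fun GT mU.
apply/eqP; rewrite -subr_eq0 -RintegralB//; do ?exact: integrableMl_real UB _.
under eq_Rintegral do rewrite -mulrBr.
apply/eqP/(@Rintegral_mulr_eq0 B) => // [|A GA]; first exact: integrableB_real.
have mA := GT GA.
rewrite RintegralB//; [|exact: integrableS iX|exact: integrableS iY].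
by rewrite /Rintegral XY// subrr.
Qed.

End conditional_expectation.

(** * Exponential increments and sums over blocks *)

(** Convexity: [expR] lies above its tangent line at [x]. *)
Lemma expRB_le (R : realType) (x y : R) : expR x - expR y <= expR x * (x - y).
Proof.
have -> : y = x + (y - x) by ring.
rewrite expRD opprD opprB addrA subrr add0r -{1}[expR x]mulr1 -mulrBr ler_wpM2l ?expR_ge0//.
have := expR_ge1Dx (y - x); lra.
Qed.

(** Blocks are numbered from 1, as in M2 and M3, hence [m.-1]. *)
Lemma sum_nat_blocks (R : zmodType) (g : nat -> R) (K l : nat) :
  \sum_(0 <= j < l * K) g j =
  \sum_(1 <= m < l.+1) \sum_(m.-1 * K <= j < m * K) g j.
Proof.
elim: l => [|l IH]; first by rewrite mul0n !big_geq.
rewrite big_nat_recr//= -IH -big_cat_nat//=.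
by rewrite leq_mul2r leqnSn orbT.
Qed.

Lemma partial_sumS T (R : realType) (X : nat -> T -> R) N w :
  partial_sum X N.+1 w = partial_sum X N w + X N.+1 w.
Proof. by rewrite /partial_sum big_nat_recr. Qed.

Lemma partial_sumE T (R : realType) (X : nat -> T -> R) N w :
  partial_sum X N w = \sum_(0 <= j < N) X j.+1 w.
Proof. by rewrite /partial_sum big_add1. Qed.

Lemma partial_sumB T (R : realType) (X : nat -> T -> R) m n w : (m <= n)%N ->
  partial_sum X n w - partial_sum X m w = \sum_(m <= j < n) X j.+1 w.
Proof.
by move=> mn; rewrite !partial_sumE (@big_cat_nat _ _ _ m 0 n)//= addrAC subrr add0r.
Qed.

(** * Nonasymptotic estimates for martingale differences, with [s2] in the role of sigma^2 *)

Section martingale_differences.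
Context d (T : measurableType d) (R : realType) (P : probability T R).
Context (F : nat -> set (set T)) (Z V : nat -> T -> R) (W : nat -> nat -> T -> R).
Context (C s2 : R).
Context (hF : filtration F).
Context (hZ_adapted : forall n, (1 <= n)%N -> measurable_wrt (F n) (Z n)).
Context (hZ_diff : forall n, (1 <= n)%N ->
  is_cond_expectation P (F n.-1) (Z n) (fun=> 0%R)).
Context (hV : forall j, (1 <= j)%N ->
  is_cond_expectation P (F j.-1) (fun w => (Z j w ^+ 2)%R) (V j)).
Context (hW : forall K m, (1 <= K)%N -> (1 <= m)%N ->
  is_cond_expectation P (F (m.-1 * K)%N)
    (fun w => (partial_sum V (m * K) w - partial_sum V (m.-1 * K) w)%R) (W K m)).
Context (hC : forall j, \int[P]_w (Z j.+1 w ^+ 2) <= C).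
Context (s20 : 0 <= s2).

Let sF n : sigma_algebra [set: T] (F n). Proof. by case: hF. Qed.
Let FT n : F n `<=` measurable. Proof. by case: hF. Qed.
Let FS m n : (m <= n)%N -> F m `<=` F n. Proof. by case: hF => _ _; exact. Qed.

Lemma integrable_Z j : P.-integrable setT (EFin \o Z j.+1).
Proof. by case: (hZ_diff (ltn0Sn j)). Qed.

Lemma integrable_sqrZ j : P.-integrable setT (EFin \o (fun w => Z j.+1 w ^+ 2)).
Proof. by case: (hV (ltn0Sn j)). Qed.

Lemma integrable_V j : P.-integrable setT (EFin \o V j.+1).
Proof. by case: (hV (ltn0Sn j)). Qed.

Lemma integrable_W K m : (0 < K)%N -> (0 < m)%N ->
  P.-integrable setT (EFin \o W K m).
Proof. by move=> K0 m0; case: (hW K0 m0). Qed.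

Lemma Rintegral_sqrZ_ge0 j : 0 <= \int[P]_w (Z j.+1 w ^+ 2).
Proof. by apply: Rintegral_ge0 => w _; exact: sqr_ge0. Qed.

Lemma measurable_wrt_partial_sum N : measurable_wrt (F N) (partial_sum Z N).
Proof.
rewrite /partial_sum.
have : forall n, (n <= N)%N -> measurable_wrt (F N) (fun w => \sum_(1 <= j < n.+1) Z j w).
  elim=> [|n IH] nN.
    under eq_fun do rewrite big_geq//.
    exact: measurable_wrt_cst.
  under eq_fun do rewrite big_nat_recr//=.
  apply: measurable_wrtD => //; first by apply: IH; exact: ltnW.
  exact: (measurable_wrtS (FS nN) (hZ_adapted (ltn0Sn n))).
by apply.
Qed.

Lemma measurable_partial_sum N : measurable_fun setT (partial_sum Z N).
Proof. exact: measurable_wrt_fun (@FT N) (measurable_wrt_partial_sum N). Qed.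

Lemma measurable_normZ_ge (r : R) j : measurable [set w | r <= `|Z j.+1 w|].
Proof.
have mZ : measurable_fun setT (fun w => `|Z j.+1 w|).
  apply: measurableT_comp => //.
  exact: measurable_wrt_fun (@FT j.+1) (hZ_adapted (ltn0Sn j)).
have := mZ measurableT _ (measurable_itv `[r, +oo[); rewrite setTI.
by congr measurable; apply/seteqP; split => w /=; rewrite in_itv/= andbT.
Qed.

Lemma measurable_increment_ge (r : R) i j :
  measurable [set w | r <= `|partial_sum Z j w - partial_sum Z i w|].
Proof.
have mM : measurable_fun setT (fun w => `|partial_sum Z j w - partial_sum Z i w|).
  by apply: measurableT_comp => //; apply: measurable_funB; exact: measurable_partial_sum.
have := mM measurableT _ (measurable_itv `[r, +oo[); rewrite setTI.
by congr measurable; apply/seteqP; split => w /=; rewrite in_itv/= andbT.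
Qed.

(** * Block decomposition for bounded adapted weights *)

Section blocks.
Context (B : R) (Y : nat -> T -> R).
Context (mY : forall j, measurable_wrt (F j) (Y j)).
Context (YB : forall j w, `|Y j w| <= B).

Let B0 : 0 <= B. Proof. exact: le_trans (normr_ge0 _) (YB 0 point). Qed.
Let mYT j : measurable_fun setT (Y j). Proof. exact: measurable_wrt_fun (@FT j) _. Qed.

Let isqrZB j : P.-integrable setT (EFin \o (fun w => Z j.+1 w ^+ 2 - s2)).
Proof.
apply: integrableB_real; first exact: integrable_sqrZ.
exact: integrable_cst_prob.
Qed.

Let isqrZD j : P.-integrable setT (EFin \o (fun w => Z j.+1 w ^+ 2 + s2)).
Proof.
apply: integrableD_real; first exact: integrable_sqrZ.
exact: integrable_cst_prob.
Qed.

Let norm_sqrZB j w : `|Z j.+1 w ^+ 2 - s2| <= Z j.+1 w ^+ 2 + s2.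
Proof.
by rewrite (le_trans (ler_normB _ _))// !ger0_norm// sqr_ge0.
Qed.

(** [Y j] pulls out of the conditioning on [F j], under which [Z j.+1] has mean zero. *)
Lemma Rintegral_mul_Z j : \int[P]_w (Y j w * Z j.+1 w) = 0.
Proof.
rewrite (cond_expectation_mul (sF j) (@FT j) (hZ_diff (ltn0Sn j)) (mY j) (YB j)).
under eq_Rintegral do rewrite mulr0.
exact: Rintegral_cst_prob.
Qed.

(** Crude estimate, meant for the incomplete block at the end. *)
Lemma norm_Rintegral_mul_sqrZB j :
  `|\int[P]_w (Y j w * (Z j.+1 w ^+ 2 - s2))| <= B * (C + s2).
Proof.
have le1 : `|\int[P]_w (Y j w * (Z j.+1 w ^+ 2 - s2))| <=
    \int[P]_w (B * (Z j.+1 w ^+ 2 + s2)).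
  apply: norm_Rintegral_le.
  - exact: integrableMl_real (YB j) _.
  - exact: integrableZl_real.
  - by move=> w; rewrite normrM ler_pM.
apply: (le_trans le1); rewrite RintegralZl//.
rewrite ler_wpM2l// RintegralD//; [|exact: integrable_sqrZ|exact: integrable_cst_prob].
by rewrite lerD ?hC// Rintegral_cst_prob.
Qed.

Lemma block_conditioning K m : (0 < K)%N -> (0 < m)%N ->
  \sum_(m.-1 * K <= j < m * K)
    \int[P]_w (Y (m.-1 * K)%N w * (Z j.+1 w ^+ 2 - s2)) =
  \int[P]_w (Y (m.-1 * K)%N w * (W K m w - K%:R * s2)).
Proof.
move=> K0 m0; set i := (m.-1 * K)%N.
have im : (i <= m * K)%N by rewrite leq_mul2r leq_pred orbT.
have iYs (c : R) : P.-integrable setT (EFin \o (fun w => Y i w * c)).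
  by apply: integrableMl_real (YB i) (integrable_cst_prob _ _).
have iYW : P.-integrable setT (EFin \o (fun w => Y i w * W K m w)).
  by apply: integrableMl_real (YB i) (integrable_W _ _).
have iYZ j : P.-integrable setT (EFin \o (fun w => Y i w * Z j.+1 w ^+ 2)).
  by apply: integrableMl_real (YB i) (integrable_sqrZ _).
have iYV j : P.-integrable setT (EFin \o (fun w => Y i w * V j.+1 w)).
  by apply: integrableMl_real (YB i) (integrable_V _).
under [RHS]eq_Rintegral do rewrite mulrBr.
rewrite RintegralB//.
rewrite -(cond_expectation_mul (sF i) (@FT i) (hW K0 m0) (mY i) (YB i)).
rewrite (eq_bigr (fun j => \int[P]_w (Y i w * Z j.+1 w ^+ 2) -
  \int[P]_w (Y i w * s2))) => [|j _]; last first.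
  by under eq_Rintegral do rewrite mulrBr; rewrite RintegralB.
rewrite sumrB; congr (_ - _).
  under [RHS]eq_Rintegral do rewrite partial_sumB// mulr_sumr.
  rewrite Rintegral_sum//; apply: eq_big_nat => j /andP[ij _].
  rewrite (cond_expectation_mul (sF j) (@FT j) (hV (ltn0Sn j)) _ (YB i))//.
  exact: measurable_wrtS (FS ij) (mY i).
rewrite sumr_const_nat -mulnBl.
have -> : (m - m.-1)%N = 1%N by case: m m0 {im i iYs iYW iYZ iYV} => // m _; rewrite subSnn.
rewrite mul1n -[LHS]mulr_natl -RintegralZl//.
by apply: eq_Rintegral => w _; ring.
Qed.

Lemma block_bound K m : (0 < K)%N -> (0 < m)%N ->
  `|\sum_(m.-1 * K <= j < m * K) \int[P]_w (Y j w * (Z j.+1 w ^+ 2 - s2))| <=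
  B * (K%:R * \int[P]_w `|K%:R^-1 * W K m w - s2|) +
  \sum_(m.-1 * K <= j < m * K)
    \int[P]_w (`|Y j w - Y (m.-1 * K)%N w| * (Z j.+1 w ^+ 2 + s2)).
Proof.
move=> K0 m0; set i := (m.-1 * K)%N.
have KR : K%:R != 0 :> R by rewrite pnatr_eq0 -lt0n.
have mYi j : measurable_fun setT (fun w => Y j w - Y i w) by exact: measurable_funB.
have YiB j w : `|Y j w - Y i w| <= B + B.
  by rewrite (le_trans (ler_normB _ _))// lerD.
have iW := integrable_W K0 m0.
have iWs : P.-integrable setT (EFin \o (fun w => K%:R^-1 * W K m w - s2)).
  apply: integrableB_real; first exact: integrableZl_real.
  exact: integrable_cst_prob.
have iWs' : P.-integrable setT (EFin \o (fun w => W K m w - K%:R * s2)).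
  by apply: integrableB_real => //; exact: integrable_cst_prob.
rewrite (eq_bigr (fun j => \int[P]_w (Y i w * (Z j.+1 w ^+ 2 - s2)) +
    \int[P]_w ((Y j w - Y i w) * (Z j.+1 w ^+ 2 - s2)))) => [|j _]; last first.
  rewrite -RintegralD//; first by apply: eq_Rintegral => w _; ring.
  - exact: integrableMl_real (YB i) _.
  - exact: integrableMl_real (YiB j) _.
rewrite big_split/= block_conditioning// -/i.
rewrite (le_trans (ler_normD _ _))// lerD//.
  rewrite mulrA -RintegralZl//; last exact: integrable_norm_real.
  apply: norm_Rintegral_le.
  - exact: integrableMl_real (YB i) _.
  - by apply: integrableZl_real; exact: integrable_norm_real.
  move=> w; rewrite normrM -mulrA ler_pM//.
  rewrite -[leRHS](@ger0_norm _ (_ * _)) ?mulr_ge0// normrM normr_id -normrM.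
  by rewrite mulrBr mulrA divff// mul1r.
rewrite (le_trans (ler_norm_sum _ _ _))// ler_sum// => j _.
apply: norm_Rintegral_le.
- exact: integrableMl_real (YiB j) _.
- apply: (@integrableMl_real _ _ _ _ (B + B)) => //.
    exact: measurableT_comp.
  by move=> w; rewrite normr_id.
- by move=> w; rewrite normrM ler_wpM2l.
Qed.

(** There are [N %/ K] complete blocks, plus fewer than [K] leftover terms that are bounded one by
    one. *)
Lemma sum_bound K N : (0 < K)%N ->
  `|\sum_(0 <= j < N) \int[P]_w (Y j w * (Z j.+1 w ^+ 2 - s2))| <=
  B * (K%:R * \sum_(1 <= m < (N %/ K).+1) \int[P]_w `|K%:R^-1 * W K m w - s2|) +
  \sum_(1 <= m < (N %/ K).+1) \sum_(m.-1 * K <= j < m * K)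
    \int[P]_w (`|Y j w - Y (m.-1 * K)%N w| * (Z j.+1 w ^+ 2 + s2)) +
  K%:R * (B * (C + s2)).
Proof.
move=> K0; rewrite (@big_cat_nat _ _ _ (N %/ K * K)%N)//= ?leq_divM// sum_nat_blocks.
have C0 : 0 <= C := le_trans (Rintegral_sqrZ_ge0 0) (hC 0).
rewrite (le_trans (ler_normD _ _))// lerD//.
  rewrite (le_trans (ler_norm_sum _ _ _))// !mulr_sumr -big_split/= ler_sum_nat//.
  by move=> m /andP[m0 _]; exact: block_bound.
rewrite (le_trans (ler_norm_sum _ _ _))//.
apply: (@le_trans _ _ (\sum_(N %/ K * K <= j < N) B * (C + s2))).
  by apply: ler_sum => j _; exact: norm_Rintegral_mul_sqrZB.
rewrite sumr_const_nat -[leLHS]mulr_natl ler_wpM2r ?mulr_ge0 ?addr_ge0// ler_nat.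
by rewrite {1}(divn_eq N K) addKn ltnW// ltn_mod.
Qed.

End blocks.

(** * Quantitative bound on E cos(theta M_N / sqrt N + phi) *)

Section characteristic_function.
Context (theta phi eps : R) (N : nat).
Context (eps0 : 0 <= eps) (N0 : (0 < N)%N).

Let sq : R := Num.sqrt N%:R.
Let a : R := theta / sq.
(** Equal to [a^2 s2 / 2], the expected relative decay of the cosine per step; the weight [e] grows
    at the same rate to compensate. *)
Let c : R := s2 * theta ^+ 2 / 2 / N%:R.
(** The final weight [e N], which bounds all the others. *)
Let B : R := expR (s2 * theta ^+ 2 / 2).
Let u j w := a * partial_sum Z j w + phi.
(* Truncated at [N] so that [eB] below holds for every [j]. *)
Let e j : R := expR (c * (minn j N)%:R).
(** The weight is taken at [j.+1] because [step] factors [e j.+1] out of a whole increment; being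
    deterministic, it does not affect adaptedness. *)
Let Y j w := e j.+1 * cos (u j w).

Let NR : 0 < N%:R :> R. Proof. by rewrite ltr0n. Qed.
Let sq0 : 0 < sq. Proof. by rewrite sqrtr_gt0. Qed.
Let sqE : sq ^+ 2 = N%:R. Proof. by rewrite sqr_sqrtr. Qed.
Let a2E : a ^+ 2 = theta ^+ 2 / N%:R. Proof. by rewrite expr_div_n sqE. Qed.
Let norm_a_sq : `|a| * sq = `|theta|.
Proof. by rewrite normrM normfV (gtr0_norm sq0) divfK// gt_eqF. Qed.
Let cE : c = a ^+ 2 / 2 * s2.
Proof. by rewrite a2E /c; field; rewrite gt_eqF. Qed.
Let c0 : 0 <= c. Proof. by rewrite cE mulr_ge0// divr_ge0// sqr_ge0. Qed.
Let B0 : 0 < B. Proof. exact: expR_gt0. Qed.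
Let e0 j : 0 < e j. Proof. exact: expR_gt0. Qed.

Let eB j : e j <= B.
Proof.
rewrite ler_expR (@le_trans _ _ (c * N%:R))//.
  by rewrite ler_wpM2l// ler_nat geq_minr.
by rewrite /c divfK// gt_eqF.
Qed.

Let mu_ j : measurable_wrt (F j) (u j).
Proof.
apply: (@measurable_wrt_comp _ _ _ _ (fun x => a * x + phi)).
  by apply: measurable_funD => //; exact: mulrl_measurable.
exact: measurable_wrt_partial_sum.
Qed.

Let mcosu j : measurable_wrt (F j) (fun w => cos (u j w)).
Proof.
apply: measurable_wrt_comp (mu_ j).
exact: continuous_measurable_fun (@continuous_cos R).
Qed.

Let msinu j : measurable_wrt (F j) (fun w => sin (u j w)).
Proof.
apply: measurable_wrt_comp (mu_ j).
exact: continuous_measurable_fun (@continuous_sin R).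
Qed.

Let mY j : measurable_wrt (F j) (Y j).
Proof. by apply: measurable_wrt_comp (mcosu j); exact: mulrl_measurable. Qed.

Let YB j w : `|Y j w| <= B.
Proof.
rewrite normrM gtr0_norm// (le_trans _ (eB j.+1))//.
by rewrite ler_piMr ?cos_max// ltW.
Qed.

Let icosu j : P.-integrable setT (EFin \o (fun w => cos (u j w))).
Proof.
apply: (@le_integrable_real _ _ _ _ _ (fun=> 1)); last exact: integrable_cst_prob.
  exact: measurable_wrt_fun (@FT j) _.
by move=> w; exact: cos_max.
Qed.

Let exit j := [set w | eps * sq <= `|Z j.+1 w|].

Let isqrZ1 j : P.-integrable setT (EFin \o (fun w => Z j.+1 w ^+ 2 * \1_(exit j) w)).
Proof. by apply: integrable_mul_indic (integrable_sqrZ j); exact: measurable_normZ_ge. Qed.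

Let rem j w := cos (u j.+1 w) -
  (cos (u j w) - a * Z j.+1 w * sin (u j w) - (a * Z j.+1 w) ^+ 2 / 2 * cos (u j w)).

Let uS j w : u j.+1 w = u j w + a * Z j.+1 w.
Proof. by rewrite /u partial_sumS; ring. Qed.

(** The quadratic Taylor bound serves on [exit j], the cubic one off it, where
    [|Z j.+1| <= eps * sq] absorbs one factor. *)
Let rem_bound j w : `|rem j w| <=
  2 * a ^+ 2 * (Z j.+1 w ^+ 2 * \1_(exit j) w) + `|a| ^+ 3 * (eps * sq) * Z j.+1 w ^+ 2.
Proof.
rewrite /rem uS indicE; have [zb|zb] := boolP (w \in exit j).
  rewrite mulr1 (le_trans (cosD_remainder_le2 _ _))// exprMn mulrA lerDl.
  by rewrite mulr_ge0 ?sqr_ge0// mulr_ge0 ?exprn_ge0// mulr_ge0// ltW.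
rewrite mulr0 mulr0 add0r (le_trans (cosD_remainder_le3 _ _))//.
rewrite normrM exprMn -mulrA ler_wpM2l ?exprn_ge0// exprSr mulrC.
rewrite real_normK ?num_real// ler_wpM2r ?sqr_ge0//.
by move: zb; rewrite notin_setE /exit/= => /negP; rewrite -ltNge => /ltW.
Qed.

Let icu j : P.-integrable setT (EFin \o (fun w => cos (u j w) * Z j.+1 w ^+ 2)).
Proof.
apply: (@integrableMl_real _ _ _ _ 1);
  [|by move=> w; exact: cos_max|exact: integrable_sqrZ].
exact: measurable_wrt_fun (@FT j) _.
Qed.

Let isu j : P.-integrable setT (EFin \o (fun w => sin (u j w) * Z j.+1 w)).
Proof.
apply: (@integrableMl_real _ _ _ _ 1);
  [|by move=> w; exact: sin_max|exact: integrable_Z].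
exact: measurable_wrt_fun (@FT j) _.
Qed.

Let remE j : rem j = (fun w => cos (u j.+1 w) - cos (u j w) +
  (a * (sin (u j w) * Z j.+1 w) + a ^+ 2 / 2 * (cos (u j w) * Z j.+1 w ^+ 2))).
Proof. by apply/funext => w; rewrite /rem; field. Qed.

Let irem j : P.-integrable setT (EFin \o rem j).
Proof.
rewrite remE; apply: integrableD_real; first exact: integrableB_real.
by apply: integrableD_real; exact: integrableZl_real.
Qed.

(** The first order term integrates to zero because [sin (u j)] is bounded and [F j]-measurable. *)
Let Rintegral_cosS j : \int[P]_w cos (u j.+1 w) = \int[P]_w cos (u j w) -
  a ^+ 2 / 2 * \int[P]_w (cos (u j w) * Z j.+1 w ^+ 2) + \int[P]_w rem j w.
Proof.
rewrite [in RHS]remE RintegralD//; last 2 first.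
- exact: integrableB_real.
- by apply: integrableD_real; exact: integrableZl_real.
rewrite RintegralB// RintegralD//; [|exact: integrableZl_real..].
rewrite !RintegralZl// (@Rintegral_mul_Z 1 (fun j w => sin (u j w)))//; last first.
  by move=> ? ?; exact: sin_max.
ring.
Qed.

Let Rintegral_rem_bound j : `|\int[P]_w rem j w| <=
  2 * a ^+ 2 * \int[P]_w (Z j.+1 w ^+ 2 * \1_(exit j) w) + `|a| ^+ 3 * (eps * sq) * C.
Proof.
have i2 : P.-integrable setT (EFin \o
    (fun w => 2 * a ^+ 2 * (Z j.+1 w ^+ 2 * \1_(exit j) w))).
  exact: integrableZl_real.
have i3 : P.-integrable setT (EFin \o (fun w => `|a| ^+ 3 * (eps * sq) * Z j.+1 w ^+ 2)).
  by apply: integrableZl_real; exact: integrable_sqrZ.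
apply: le_trans (norm_Rintegral_le (irem j) (integrableD_real i2 i3) (rem_bound j)) _.
rewrite RintegralD// !RintegralZl//; last exact: integrable_sqrZ.
by rewrite lerD2l ler_wpM2l ?hC// mulr_ge0 ?exprn_ge0// mulr_ge0// ltW.
Qed.

(** The telescoping quantity: it starts at [cos phi] and ends at [B * E cos (u N)]. *)
Let g j : R := e j * \int[P]_w cos (u j w).

(** [1 - c <= exp (-c) <= 1 / (1 + c) <= 1 - c + c^2], the last inequality because
    [(1 - c + c^2) (1 + c) = 1 + c^3]. *)
Let expRN_remainder : `|1 - expR (- c) - c| <= c ^+ 2.
Proof.
have cge0 := c0.
have h1 := expR_ge1Dx (- c).
have h2 : expR (- c) <= (1 + c)^-1.
  by rewrite expRN lef_pV2 ?posrE ?expR_gt0 ?expR_ge1Dx// ltr_wpDr.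
have h3 : (1 + c)^-1 <= 1 - c + c ^+ 2.
  rewrite -[leLHS]mul1r ler_pdivrMr; last lra.
  have : 0 <= c ^+ 3 by rewrite exprn_ge0.
  rewrite (_ : c ^+ 3 = (1 - c + c ^+ 2) * (1 + c) - 1); last ring.
  by rewrite subr_ge0.
rewrite ler_norml; apply/andP; split; first by lra.
by have := sqr_ge0 c; lra.
Qed.

(** By the choice of [c], the [s2] term cancels the first order part of [1 - expR (- c)]; only a
    second order error and the Taylor remainder survive. *)
Let step j : (j < N)%N ->
  `|g j.+1 - g j + a ^+ 2 / 2 * \int[P]_w (Y j w * (Z j.+1 w ^+ 2 - s2))| <=
  B * (c ^+ 2 + (2 * a ^+ 2 * \int[P]_w (Z j.+1 w ^+ 2 * \1_(exit j) w) +
                 `|a| ^+ 3 * (eps * sq) * C)).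
Proof.
move=> jN.
(* Since [j < N], the truncation in [e] is inactive at both [j] and [j.+1]. *)
have eE : e j = e j.+1 * expR (- c).
  rewrite /e (minn_idPl jN) (minn_idPl (ltnW jN)) -expRD -natr1; congr expR; ring.
have YE : \int[P]_w (Y j w * (Z j.+1 w ^+ 2 - s2)) =
    e j.+1 * (\int[P]_w (cos (u j w) * Z j.+1 w ^+ 2) - s2 * \int[P]_w cos (u j w)).
  rewrite -RintegralZl// -RintegralB//; last exact: integrableZl_real.
  rewrite -RintegralZl//; last by apply: integrableB_real => //; exact: integrableZl_real.
  by apply: eq_Rintegral => w _; rewrite /Y; ring.
rewrite YE /g eE Rintegral_cosS.
set I := \int[P]_w cos (u j w); set J := \int[P]_w (cos _ * _).
set Q := \int[P]_w rem j w.
have -> : e j.+1 * (I - a ^+ 2 / 2 * J + Q) - e j.+1 * expR (- c) * I +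
    a ^+ 2 / 2 * (e j.+1 * (J - s2 * I)) =
    e j.+1 * ((1 - expR (- c) - c) * I + Q) by rewrite cE; ring.
rewrite normrM gtr0_norm// ler_pM ?(ltW (e0 _))//.
rewrite (le_trans (ler_normD _ _))// lerD ?Rintegral_rem_bound//.
rewrite normrM -[leRHS]mulr1 ler_pM//.
rewrite -(Rintegral_cst_prob P 1); apply: norm_Rintegral_le => //.
  exact: integrable_cst_prob.
by move=> w; exact: cos_max.
Qed.

(** Sum [step] over [j < N]: [a^2 = theta^2 / N] produces averages, and [N |a|^3 sqrt N = |theta|^3]
    makes the cubic error of order [eps]. *)
Lemma telescoping_bound : `|B * \int[P]_w cos (u N w) - cos phi| <=
  B * (N%:R * c ^+ 2 + 2 * theta ^+ 2 *
    (N%:R^-1 * \sum_(0 <= j < N) \int[P]_w (Z j.+1 w ^+ 2 * \1_(exit j) w)) +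
    `|theta| ^+ 3 * eps * C) +
  theta ^+ 2 / 2 * (N%:R^-1 *
    `|\sum_(0 <= j < N) \int[P]_w (Y j w * (Z j.+1 w ^+ 2 - s2))|).
Proof.
have -> : B * \int[P]_w cos (u N w) - cos phi = g N - g 0.
  rewrite /g /e min0n mulr0 expR0 mul1r minnn; congr (_ * _ - _).
    by congr expR; rewrite /c divfK// gt_eqF.
  rewrite -(Rintegral_cst_prob P (cos phi)); apply: eq_Rintegral => w _.
  by rewrite /u /partial_sum big_geq// mulr0 add0r.
rewrite -telescope_sumr//.
set S := \sum_(0 <= j < N) \int[P]_w (Y j w * _).
have -> : \sum_(0 <= j < N) (g j.+1 - g j) =
    \sum_(0 <= j < N) (g j.+1 - g j + a ^+ 2 / 2 *
      \int[P]_w (Y j w * (Z j.+1 w ^+ 2 - s2))) - a ^+ 2 / 2 * S.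
  by rewrite /S mulr_sumr -sumrB; apply: eq_bigr => j _; rewrite addrK.
rewrite (le_trans (ler_normB _ _))// lerD//; last first.
  rewrite normrM ger0_norm ?divr_ge0 ?sqr_ge0// a2E.
  by rewrite le_eqVlt; apply/orP; left; apply/eqP; ring.
rewrite (le_trans (ler_norm_sum _ _ _))//.
rewrite (le_trans (ler_sum_nat (fun j jN => step (andP jN).2)))//.
rewrite -mulr_sumr ler_wpM2l ?(ltW B0)// !big_split/= !sumr_const_nat subn0 -mulr_sumr.
rewrite -[c ^+ 2 *+ N]mulr_natl -[(_ * C) *+ N]mulr_natl addrA lerD//.
  by rewrite lerD2l a2E le_eqVlt; apply/orP; left; apply/eqP; ring.
have -> : `|a| ^+ 3 * (eps * sq) = `|theta| ^+ 3 * eps / N%:R.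
  rewrite -norm_a_sq -sqE; field.
  by rewrite gt_eqF.
rewrite le_eqVlt; apply/orP; left; apply/eqP; field.
by rewrite gt_eqF.
Qed.

Let far i j := [set w | eps * sq <= `|partial_sum Z j w - partial_sum Z i w|].

(** Convexity of [expR] bounds the drift of the weight over at most [K] steps. Off [far i j] the
    argument of the cosine moves by at most [|theta| * eps]; on it the cosine itself moves by at
    most 2. *)
Let Y_increment K i j w : (i <= j <= i + K)%N ->
  `|Y j w - Y i w| <= B * (c * K%:R + `|theta| * eps) + 2 * B * \1_(far i j) w.
Proof.
move=> /andP[ij jK].
have -> : Y j w - Y i w =
    (e j.+1 - e i.+1) * cos (u i w) + e j.+1 * (cos (u j w) - cos (u i w)).
  by rewrite /Y; ring.
rewrite (le_trans (ler_normD _ _))// [B * (_ + _)]mulrDr -[leRHS]addrA lerD//.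
  rewrite normrM -[leRHS]mulr1 ler_pM ?cos_max//.
  have ee : e i.+1 <= e j.+1.
    by rewrite ler_expR ler_wpM2l// ler_nat; lia.
  rewrite ger0_norm ?subr_ge0// (le_trans (expRB_le _ _))//.
  rewrite ler_pM ?(ltW (e0 _)) ?eB//.
    by rewrite -mulrBr mulr_ge0// subr_ge0 ler_nat; lia.
  rewrite -mulrBr ler_wpM2l// lerBlDr -natrD ler_nat.
  lia.
have -> : B * (`|theta| * eps) + 2 * B * \1_(far i j) w =
  B * (`|theta| * eps + 2 * \1_(far i j) w) by ring.
rewrite normrM gtr0_norm// ler_pM ?(ltW (e0 _)) ?eB// indicE.
have [zb|zb] := boolP (w \in far i j).
  rewrite (le_trans (ler_normB _ _))// mulr1.
  have := cos_max (u j w); have := cos_max (u i w).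
  have : 0 <= `|theta| * eps by exact: mulr_ge0.
  lra.
rewrite mulr0 addr0 (le_trans (dist_cos_le _ _))//.
have -> : u j w - u i w = a * (partial_sum Z j w - partial_sum Z i w).
  by rewrite /u; ring.
rewrite normrM -norm_a_sq -mulrA ler_wpM2l// mulrC.
by move: zb; rewrite notin_setE /far/= => /negP; rewrite -ltNge => /ltW.
Qed.


Let integrable_1DsqrZ j : P.-integrable setT (EFin \o (fun w => 1 + Z j.+1 w ^+ 2)).
Proof.
by apply: integrableD_real; [exact: integrable_cst_prob|exact: integrable_sqrZ].
Qed.

(** M3 normalises by the total length of the complete blocks, so [r] will be the square root of
    [N %/ K * K], at most [sq]; a smaller threshold only enlarges the event. *)
Let Rintegral_Y_increment (r : R) K i j : 0 <= r <= sq -> (i <= j <= i + K)%N ->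
  \int[P]_w (`|Y j w - Y i w| * (Z j.+1 w ^+ 2 + s2)) <=
  B * (c * K%:R + `|theta| * eps) * (C + s2) +
  2 * B * (1 + s2) * \int[P]_w ((1 + Z j.+1 w ^+ 2) *
    \1_[set w | eps * r <= `|partial_sum Z j w - partial_sum Z i w|] w).
Proof.
move=> /andP[r0 rsq] ijK; set A := [set w | _].
have iZs : P.-integrable setT (EFin \o (fun w => Z j.+1 w ^+ 2 + s2)).
  by apply: integrableD_real; [exact: integrable_sqrZ|exact: integrable_cst_prob].
have i1 : P.-integrable setT (EFin \o (fun w =>
    B * (c * K%:R + `|theta| * eps) * (Z j.+1 w ^+ 2 + s2))).
  exact: integrableZl_real.
have iA : P.-integrable setT (EFin \o (fun w => (1 + Z j.+1 w ^+ 2) * \1_A w)).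
  by apply: integrable_mul_indic => //; exact: measurable_increment_ge.
have i2 : P.-integrable setT (EFin \o (fun w =>
    2 * B * (1 + s2) * ((1 + Z j.+1 w ^+ 2) * \1_A w))).
  exact: integrableZl_real.
have mYT k : measurable_fun setT (Y k) by exact: measurable_wrt_fun (@FT k) (mY k).
have iY : P.-integrable setT (EFin \o (fun w => `|Y j w - Y i w| * (Z j.+1 w ^+ 2 + s2))).
  apply: (@integrableMl_real _ _ _ _ (B + B)) => //.
    by apply: measurableT_comp => //; exact: measurable_funB.
  by move=> w; rewrite normr_id (le_trans (ler_normB _ _))// lerD.
apply: (@le_trans _ _ (\int[P]_w (B * (c * K%:R + `|theta| * eps) * (Z j.+1 w ^+ 2 + s2) +
    2 * B * (1 + s2) * ((1 + Z j.+1 w ^+ 2) * \1_A w)))).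
  apply: le_Rintegral => // [|w _]; first exact: integrableD_real.
  have Z2 : 0 <= Z j.+1 w ^+ 2 := sqr_ge0 _.
  apply: le_trans (ler_wpM2r _ (Y_increment w ijK)) _; first exact: addr_ge0.
  rewrite mulrDl lerD2l -!mulrA ler_wpM2l// ler_wpM2l ?(ltW B0)//.
  (* Here [Z^2 + s2 <= (1 + s2) (1 + Z^2)], which is the integrand of M3 up to a constant. *)
  rewrite [leRHS]mulrA mulrC ler_pM ?addr_ge0//.
    have := mulr_ge0 s20 Z2; lra.
  rewrite !indicE ler_nat; have [/set_mem zb|//] := boolP (w \in far i j).
  rewrite mem_set//; apply: le_trans zb; exact: ler_wpM2l.
rewrite RintegralD// !RintegralZl// lerD2r ler_wpM2l//.
  by rewrite mulr_ge0 ?(ltW B0)// addr_ge0 ?(mulr_ge0 c0)// mulr_ge0.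
rewrite RintegralD//; [|exact: integrable_sqrZ|exact: integrable_cst_prob].
by rewrite Rintegral_cst_prob lerD2r hC.
Qed.

Let C0 : 0 <= C. Proof. exact: le_trans (Rintegral_sqrZ_ge0 0) (hC 0). Qed.

(** The factor in front of [eps] depends only on [theta], [s2] and [C], hence is uniform in [phi],
    [K] and [N]. The two block averages are rescaled to the normalisation [1 / N], then inserted
    into [telescoping_bound] through [sum_bound]. *)
Lemma characteristic_function_bound K : (0 < K <= N)%N ->
  K%:R / N%:R <= eps ->
  N%:R^-1 * (\sum_(0 <= j < N) \int[P]_w (Z j.+1 w ^+ 2 *
    \1_[set w | eps * Num.sqrt N%:R <= `|Z j.+1 w|] w)) <= eps ->
  (N %/ K)%:R^-1 * (\sum_(1 <= m < (N %/ K).+1)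
    \int[P]_w `|K%:R^-1 * W K m w - s2|) <= eps ->
  (N %/ K * K)%:R^-1 * (\sum_(1 <= m < (N %/ K).+1) \sum_(m.-1 * K <= j < m * K)
    \int[P]_w ((1 + Z j.+1 w ^+ 2) * \1_[set w | eps * Num.sqrt (N %/ K * K)%:R
      <= `|partial_sum Z j w - partial_sum Z (m.-1 * K) w|] w)) <= eps ->
  `|\int[P]_w cos (theta / Num.sqrt N%:R * partial_sum Z N w + phi) -
    expR (- (s2 * theta ^+ 2 / 2)) * cos phi| <=
  (s2 ^+ 2 * theta ^+ 4 / 4 + 2 * theta ^+ 2 + `|theta| ^+ 3 * C +
    theta ^+ 2 / 2 * (1 + (s2 * theta ^+ 2 / 2 + `|theta|) * (C + s2) +
      2 * (1 + s2) + (C + s2))) * eps.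
Proof.
move=> /andP[K0 KN] hK hL; set l := (N %/ K)%N.
set S2 := \sum_(1 <= m < l.+1) \int[P]_w `|K%:R^-1 * W K m w - s2|.
set S3 := \sum_(1 <= m < l.+1) \sum_(m.-1 * K <= j < m * K) _ => hS2 hS3.
have l0 : (0 < l)%N by rewrite divn_gt0.
have lKN : (l * K <= N)%N by exact: leq_divM.
have KR : 0 < K%:R :> R by rewrite ltr0n.
have lR : 0 < l%:R :> R by rewrite ltr0n.
have S20 : 0 <= S2.
  by apply: sumr_ge0 => m _; apply: Rintegral_ge0 => w _; exact: normr_ge0.
have S30 : 0 <= S3.
  apply: sumr_ge0 => m _; apply: sumr_ge0 => j _; apply: Rintegral_ge0 => w _.
  by rewrite mulr_ge0// addr_ge0// sqr_ge0.
have lKle : N%:R^-1 <= (l * K)%:R^-1 :> R.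
  by rewrite lef_pV2 ?posrE ?ltr0n ?muln_gt0 ?l0// ler_nat.
(* [K / N <= 1 / l], because [l * K <= N]. *)
have hS2N : N%:R^-1 * (K%:R * S2) <= eps.
  apply: le_trans hS2; rewrite mulrA ler_wpM2r//.
  by rewrite (le_trans (ler_wpM2r (ltW KR) lKle))// natrM invfM divfK// gt_eqF.
have hS3N : N%:R^-1 * S3 <= eps.
  by apply: le_trans hS3; rewrite ler_wpM2r.
have hlKN : N%:R^-1 * (l * K)%:R <= 1 :> R.
  by rewrite mulrC ler_pdivrMr// mul1r ler_nat.
have hcK : c * K%:R <= s2 * theta ^+ 2 / 2 * eps.
  rewrite /c -mulrA [_^-1 * _]mulrC ler_wpM2l// divr_ge0// mulr_ge0// sqr_ge0//.
have hNc : N%:R * c ^+ 2 <= s2 ^+ 2 * theta ^+ 4 / 4 * eps.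
  have -> : N%:R * c ^+ 2 = s2 ^+ 2 * theta ^+ 4 / 4 * N%:R^-1.
    by rewrite /c; field; rewrite gt_eqF.
  have t4 : 0 <= theta ^+ 4 by rewrite -[4%N]/(2 * 2)%N exprM sqr_ge0.
  rewrite ler_wpM2l//; first by rewrite divr_ge0// mulr_ge0// sqr_ge0.
  (* [1 / N <= K / N <= eps], as [K >= 1]. *)
  by apply: le_trans hK; rewrite ler_peMl ?invr_ge0 ?ler1n// ltW.
have hsum := @sum_bound B Y mY YB K N K0.
have hincr : \sum_(1 <= m < l.+1) \sum_(m.-1 * K <= j < m * K)
    \int[P]_w (`|Y j w - Y (m.-1 * K)%N w| * (Z j.+1 w ^+ 2 + s2)) <=
    (l * K)%:R * (B * (c * K%:R + `|theta| * eps) * (C + s2)) + 2 * B * (1 + s2) * S3.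
  have -> : (l * K)%:R * (B * (c * K%:R + `|theta| * eps) * (C + s2)) =
      \sum_(1 <= m < l.+1) \sum_(m.-1 * K <= j < m * K)
        (B * (c * K%:R + `|theta| * eps) * (C + s2)).
    by rewrite -sum_nat_blocks sumr_const_nat subn0 mulr_natl.
  rewrite /S3 mulr_sumr -big_split/= ler_sum_nat// => m /andP[m0 _].
  rewrite mulr_sumr -big_split/= ler_sum_nat// => j /andP[mj jm].
  apply: Rintegral_Y_increment.
    by rewrite sqrtr_ge0 ler_wsqrtr// ler_nat.
  by rewrite mj/= -mulSnr prednK// ltnW.
have htel := telescoping_bound.
have hN : N%:R^-1 * `|\sum_(0 <= j < N) \int[P]_w (Y j w * (Z j.+1 w ^+ 2 - s2))| <=
    B * ((1 + (s2 * theta ^+ 2 / 2 + `|theta|) * (C + s2) +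
      2 * (1 + s2) + (C + s2)) * eps).
  have NI : 0 <= N%:R^-1 :> R by rewrite invr_ge0 ltW.
  apply: le_trans (ler_wpM2l NI hsum) _; rewrite -/l -/S2.
  apply: le_trans (ler_wpM2l NI (lerD (lerD (lexx _) hincr) (lexx _))) _.
  set X := c * K%:R + `|theta| * eps.
  have hX : X <= (s2 * theta ^+ 2 / 2 + `|theta|) * eps by rewrite mulrDl lerD2r.
  have X0 : 0 <= X by rewrite addr_ge0 ?(mulr_ge0 c0)// mulr_ge0.
  have Cs0 : 0 <= C + s2 by exact: addr_ge0.
  have hlX : N%:R^-1 * (l * K)%:R * X <= (s2 * theta ^+ 2 / 2 + `|theta|) * eps.
    by apply: le_trans hX; rewrite ler_piMl.
  have -> : N%:R^-1 * (B * (K%:R * S2) + ((l * K)%:R * (B * X * (C + s2)) +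
      2 * B * (1 + s2) * S3) + K%:R * (B * (C + s2))) =
      B * (N%:R^-1 * (K%:R * S2) + N%:R^-1 * (l * K)%:R * X * (C + s2) +
        2 * (1 + s2) * (N%:R^-1 * S3) + (C + s2) * (K%:R / N%:R)) by ring.
  rewrite ler_wpM2l ?(ltW B0)//.
  have -> : (1 + (s2 * theta ^+ 2 / 2 + `|theta|) * (C + s2) + 2 * (1 + s2) +
      (C + s2)) * eps = eps + (s2 * theta ^+ 2 / 2 + `|theta|) * eps * (C + s2) +
      2 * (1 + s2) * eps + (C + s2) * eps by ring.
  apply: lerD; [apply: lerD; [apply: lerD|]|] => //.
  - by rewrite ler_wpM2r.
  - by rewrite ler_wpM2l// mulr_ge0// addr_ge0.
  - by rewrite ler_wpM2l.
have hB : `|B * \int[P]_w cos (u N w) - cos phi| <=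
    B * ((s2 ^+ 2 * theta ^+ 4 / 4 + 2 * theta ^+ 2 + `|theta| ^+ 3 * C +
    theta ^+ 2 / 2 * (1 + (s2 * theta ^+ 2 / 2 + `|theta|) * (C + s2) +
      2 * (1 + s2) + (C + s2))) * eps).
  apply: (le_trans htel); rewrite [in leRHS]mulrDl [in leRHS]mulrDr lerD//.
    rewrite ler_wpM2l ?(ltW B0)//.
    have -> : (s2 ^+ 2 * theta ^+ 4 / 4 + 2 * theta ^+ 2 + `|theta| ^+ 3 * C) * eps =
      s2 ^+ 2 * theta ^+ 4 / 4 * eps + 2 * theta ^+ 2 * eps +
      `|theta| ^+ 3 * C * eps by ring.
    apply: lerD; first apply: lerD => //.
      by rewrite ler_wpM2l// mulr_ge0// sqr_ge0.
    by rewrite mulrAC.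
  by rewrite -[in leRHS]mulrA [leRHS]mulrCA ler_wpM2l// divr_ge0// sqr_ge0.
(* Multiplying by [B] clears the exponential factor of the limit, which is its inverse. *)
rewrite -(ler_pM2l B0) -{1}(gtr0_norm B0) -normrM mulrBr expRN mulrA divff ?mul1r//.
by rewrite gt_eqF.
Qed.

End characteristic_function.

(** [sum_bound] with the constant weight 1, for which the freezing error vanishes. *)
Lemma mean_bracket_bound eps K N : (0 < K <= N)%N -> K%:R / N%:R <= eps ->
  (N %/ K)%:R^-1 * (\sum_(1 <= m < (N %/ K).+1)
    \int[P]_w `|K%:R^-1 * W K m w - s2|) <= eps ->
  `|N%:R^-1 * (\sum_(0 <= j < N) \int[P]_w (Z j.+1 w ^+ 2)) - s2| <=
  (1 + (C + s2)) * eps.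
Proof.
move=> /andP[K0 KN] hK; set l := (N %/ K)%N.
set S2 := \sum_(1 <= m < l.+1) \int[P]_w `|K%:R^-1 * W K m w - s2| => hS2.
have N0 : (0 < N)%N by exact: leq_trans KN.
have NR : 0 < N%:R :> R by rewrite ltr0n.
have l0 : (0 < l)%N by rewrite divn_gt0.
have C0 : 0 <= C := le_trans (Rintegral_sqrZ_ge0 0) (hC 0).
have S20 : 0 <= S2.
  by apply: sumr_ge0 => m _; apply: Rintegral_ge0 => w _; exact: normr_ge0.
have hS2N : N%:R^-1 * (K%:R * S2) <= eps.
  apply: le_trans hS2; rewrite mulrA ler_wpM2r//.
  rewrite mulrC ler_pdivrMr// ler_pdivlMl ?ltr0n//.
  by rewrite -natrM ler_nat leq_divM.
have m1 j : measurable_wrt (F j) (fun=> 1 : R) by exact: measurable_wrt_cst.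
have n1 (j : nat) (w : T) : `|1 : R| <= 1 by rewrite normr1.
have := @sum_bound 1 (fun _ _ => 1) m1 n1 K N K0; rewrite -/l -/S2.
rewrite [X in _ + X + _](_ : _ = 0) => [|]; last first.
  rewrite big1_seq// => m _; rewrite big1_seq// => j _.
  under eq_Rintegral do rewrite subrr normr0 mul0r.
  exact: Rintegral_cst_prob.
rewrite !mul1r addr0 => hsum.
have -> : N%:R^-1 * (\sum_(0 <= j < N) \int[P]_w (Z j.+1 w ^+ 2)) - s2 =
    N%:R^-1 * \sum_(0 <= j < N) \int[P]_w (1 * (Z j.+1 w ^+ 2 - s2)).
  have e j : \int[P]_w (1 * (Z j.+1 w ^+ 2 - s2)) = \int[P]_w (Z j.+1 w ^+ 2) - s2.
    under eq_Rintegral do rewrite mul1r.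
    rewrite RintegralB//; [|exact: integrable_sqrZ|exact: integrable_cst_prob].
    by rewrite Rintegral_cst_prob.
  under [in RHS]eq_bigr do rewrite e.
  rewrite sumrB sumr_const_nat subn0 mulrBr -[s2 *+ N]mulr_natl mulKf//.
  by rewrite gt_eqF.
rewrite normrM gtr0_norm ?invr_gt0//.
apply: le_trans (ler_wpM2l _ hsum) _; first by rewrite invr_ge0 ltW.
rewrite mulrDr mulrDl mul1r lerD// mulrA mulrC ler_wpM2l// ?addr_ge0//.
by rewrite mulrC.
Qed.

End martingale_differences.

(** * Eventual inequalities from limits, and limits of complex sequences *)

Section limits.
Context {R : realType}.
Implicit Types (u : nat -> \bar R) (f g : nat -> R).

Lemma cvge0_near_lt u (e : R) : u n @[n --> \oo] --> 0%E -> 0 < e ->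
  \forall n \near \oo, (u n < e%:E)%E.
Proof.
by move=> u0 e0; exact: u0 _ (@nbhs_open_ereal_lt R 0 (cst e) e0).
Qed.

(** The limsup is an infimum of suprema over the sets of the filter, so one of these sets already
    has its supremum below [a]. *)
Lemma limn_esup_near_lt u (a : \bar R) : (limn_esup u < a)%E ->
  \forall n \near \oo, (u n < a)%E.
Proof.
move=> /ereal_inf_lt[_ [A nA <-] Aa].
apply: filterS nA => n An; apply: le_lt_trans Aa.
by apply: ereal_sup_ubound; exists n.
Qed.

(** Passes from many blocks to many steps: for fixed [K], the number of complete blocks tends to
    infinity with [N]. *)
Lemma near_divn (Q : nat -> Prop) K : (0 < K)%N ->
  (\forall l \near \oo, Q l) -> \forall N \near \oo, Q (N %/ K)%N.
Proof.
move=> K0 [L _ LQ]; exists (L * K)%N => // N /= LN.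
by apply: LQ; rewrite /= leq_divRL.
Qed.

Lemma near_div_le (r e : R) : 0 < e -> \forall N \near \oo, r / N%:R <= e.
Proof.
move=> e0; exists (Num.truncn (r / e)).+1 => // N /= rN.
rewrite ler_pdivrMr; last by rewrite ltr0n (leq_trans _ rN).
rewrite mulrC -ler_pdivrMr// (le_trans (ltW (truncnS_gt _)))// ler_nat//.
Qed.

Lemma cvg_complex f g (a b : R) : f n @[n --> \oo] --> a ->
  g n @[n --> \oo] --> b ->
  (f n +i* g n : R[i]^o) @[n --> \oo] --> (a +i* b : R[i]^o).
Proof.
move=> fa gb; apply/cvgrPdist_le => /= e e0.
(* In the order of [R[i]] a positive element has zero imaginary part. *)
have eE : e = (complex.Re e)%:C.
  by move: e0; case: e => x y; rewrite ltcE/= => /andP[/eqP ->].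
have re0 : 0 < complex.Re e / 2 by move: e0; rewrite eE ltcR => ?; rewrite divr_gt0.
have /cvgrPdist_le/(_ _ re0) na := fa; have /cvgrPdist_le/(_ _ re0) nb := gb.
near=> n; rewrite eE normc_def/= lecR.
have ha : `|a - f n| <= complex.Re e / 2 by near: n.
have hb : `|b - g n| <= complex.Re e / 2 by near: n.
(* The modulus is at most the sum of the absolute values of the coordinates, as comparing squares
   shows. *)
apply: (@le_trans _ _ (`|a - f n| + `|b - g n|)); last by lra.
rewrite -(@ler_pXn2r _ 2) ?nnegrE ?sqrtr_ge0 ?addr_ge0// sqr_sqrtr ?addr_ge0 ?sqr_ge0//.
rewrite [leRHS]sqrrD !real_normK ?num_real// lerD2r lerDl.
by rewrite mulrn_wge0// mulr_ge0.
Unshelve. all: by end_near. Qed.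

End limits.

(** * Passage to the limit: first [N], then [K], then the tolerance *)

Local Open Scope ereal_scope.

Theorem theorem5p1 (d : measure_display) (T : measurableType d) (R : realType)
    (P : probability T R)
    (F : nat -> set (set T)) (hF : filtration F)
    (hF0 : F 0%N = [set set0; [set: T]])
    (Z : nat -> T -> R)
    (hZ_adapted : forall n, (1 <= n)%N -> measurable_wrt (F n) (Z n))
    (hZ_square : forall n, (1 <= n)%N -> 'E_P[fun w => (Z n w ^+ 2)%R] < +oo)
    (hZ_diff : forall n, (1 <= n)%N ->
       is_cond_expectation P (F n.-1) (Z n) (fun=> 0%R))
    (* V j is (any version of) E[Z_j^2 | F_(j-1)] and
       partial_sum V N is the bracket <M>_N. *)
    (V : nat -> T -> R)
    (hV : forall j, (1 <= j)%N ->
       is_cond_expectation P (F j.-1) (fun w => (Z j w ^+ 2)%R) (V j))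
    (* W K m is (any version of)
       E[<M>_(mK) - <M>_((m-1)K) | F_((m-1)K)]. *)
    (W : nat -> nat -> T -> R)
    (hW : forall K m, (1 <= K)%N -> (1 <= m)%N ->
       is_cond_expectation P (F (m.-1 * K)%N)
         (fun w => (partial_sum V (m * K) w - partial_sum V (m.-1 * K) w)%R)
         (W K m))
    (M1 : forall e : R, (0 < e)%R ->
       (N%:R^-1)%:E * \sum_(0 <= j < N)
         expectation_on P (fun w => (Z j.+1 w ^+ 2)%R)
           [set w | (e * Num.sqrt N%:R <= `|Z j.+1 w|)%R]
       @[N --> \oo] --> 0)
    (M2_sup :
       ereal_sup [set 'E_P[fun w => (Z n w ^+ 2)%R] | n in [set n | (1 <= n)%N]]
       < +oo)
    (sigma : R) (hsigma : (0 <= sigma)%R)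
    (M2 :
       limn_esup (fun l : nat =>
         (l%:R^-1)%:E * \sum_(1 <= m < l.+1)
           'E_P[fun w => `|K%:R^-1 * W K m w - sigma ^+ 2|%R])
       @[K --> \oo] --> 0)
    (M3 : forall e : R, (0 < e)%R ->
       limn_esup (fun l : nat =>
         ((l * K)%:R^-1)%:E * \sum_(1 <= m < l.+1)
           \sum_(m.-1 * K <= j < m * K)
             expectation_on P (fun w => (1 + Z j.+1 w ^+ 2)%R)
               [set w | (e * Num.sqrt (l * K)%:R
                 <= `|partial_sum Z j w - partial_sum Z (m.-1 * K) w|)%R])
       @[K --> \oo] --> 0) :
  ((N%:R^-1)%:E * 'E_P[partial_sum V N] @[N --> \oo] --> (sigma ^+ 2)%:E) /\
  (forall theta : R,
     (complex_expectation P
        (fun w => expi (theta * partial_sum Z N w / Num.sqrt N%:R)%R) : R[i]^o)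
     @[N --> \oo]
     --> ((expR (- (sigma ^+ 2 * theta ^+ 2) / 2))%:C : R[i]^o)).
Proof.
have iZ2 j : P.-integrable setT (EFin \o (fun w => (Z j.+1 w ^+ 2)%R)).
  by case: (hV _ (ltn0Sn j)).
(* The supremum in M2 is below [+oo] by assumption and above [-oo] because it dominates the second
   moment of [Z 1], so [fine] keeps its value. *)
have [C hC] : exists C : R, forall j, (\int[P]_w (Z j.+1 w ^+ 2) <= C)%R.
  set S := ereal_sup _ in M2_sup.
  have SZ j : (\int[P]_w (Z j.+1 w ^+ 2)%R)%:E <= S.
    by rewrite -expectation_Rintegral//; apply: ereal_sup_ubound; exists j.+1.
  exists (fine S) => j; rewrite -lee_fin [(fine S)%:E]fineK; first exact: SZ.
  rewrite fin_numElt M2_sup andbT; apply: lt_le_trans (SZ 0%N).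
  by rewrite ltNyr.
have s20 : (0 <= sigma ^+ 2)%R by exact: sqr_ge0.
have iW K m : (0 < K)%N -> (0 < m)%N ->
    P.-integrable setT (EFin \o (fun w => `|K%:R^-1 * W K m w - sigma ^+ 2|%R)).
  move=> K0 m0; apply: integrable_norm_real; apply: integrableB_real.
    by apply: integrableZl_real; case: (hW _ _ K0 m0).
  exact: integrable_cst_prob.
have mM i j (r : R) :
    measurable [set w | (r <= `|partial_sum Z j w - partial_sum Z i w|)%R].
  exact: measurable_increment_ge hF hZ_adapted _ _ _.
(* M1, M2 and M3 become eventual inequalities between reals; in M1 and M3 the same [e] serves as
   threshold and as bound. *)
have L1 e : (0 < e)%R -> \forall N \near \oo,
    (N%:R^-1 * (\sum_(0 <= j < N) \int[P]_w (Z j.+1 w ^+ 2 *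
      \1_[set w | e * Num.sqrt N%:R <= `|Z j.+1 w|] w)) <= e)%R.
  move=> e0; have := cvge0_near_lt (M1 e e0) e0; apply: filterS => N.
  rewrite (eq_bigr (fun j => (\int[P]_w (Z j.+1 w ^+ 2 *
      \1_[set w | e * Num.sqrt N%:R <= `|Z j.+1 w|]%R w)%R)%:E)) => [|j _]; last first.
    rewrite /expectation_on expectation_Rintegral//.
    by apply: integrable_mul_indic => //; exact: measurable_normZ_ge hF hZ_adapted _ _.
  by rewrite sumEFin -EFinM lte_fin => /ltW.
(* The guard [0 < K] is there because the integrability of [W K m] is drawn from [hW], which starts
   at [K = 1]. *)
have L2 e : (0 < e)%R -> \forall K \near \oo, (0 < K)%N -> \forall l \near \oo,
    (l%:R^-1 * (\sum_(1 <= m < l.+1)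
      \int[P]_w `|K%:R^-1 * W K m w - sigma ^+ 2|) <= e)%R.
  move=> e0; have := cvge0_near_lt M2 e0; apply: filterS => K /limn_esup_near_lt nK K0.
  apply: filterS nK => l.
  rewrite (eq_big_nat _ _ (F2 := fun m =>
      (\int[P]_w `|K%:R^-1 * W K m w - sigma ^+ 2|)%R%:E)) => [|m /andP[m0 _]]; last first.
    by rewrite expectation_Rintegral//; exact: iW.
  by rewrite sumEFin -EFinM lte_fin => /ltW.
have L3 e : (0 < e)%R -> \forall K \near \oo, \forall l \near \oo,
    ((l * K)%:R^-1 * (\sum_(1 <= m < l.+1) \sum_(m.-1 * K <= j < m * K)
      \int[P]_w ((1 + Z j.+1 w ^+ 2) * \1_[set w | e * Num.sqrt (l * K)%:R
        <= `|partial_sum Z j w - partial_sum Z (m.-1 * K) w|] w)) <= e)%R.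
  move=> e0; have := cvge0_near_lt (M3 e e0) e0; apply: filterS => K /limn_esup_near_lt.
  apply: filterS => l.
  rewrite (eq_bigr (fun m => (\sum_(m.-1 * K <= j < m * K)
      \int[P]_w ((1 + Z j.+1 w ^+ 2) * \1_[set w | e * Num.sqrt (l * K)%:R
        <= `|partial_sum Z j w - partial_sum Z (m.-1 * K) w|] w))%R%:E)) => [|m _]; last first.
    rewrite -sumEFin; apply: eq_bigr => j _.
    rewrite /expectation_on expectation_Rintegral//; apply: integrable_mul_indic => //.
    by apply: integrableD_real => //; exact: integrable_cst_prob.
  by rewrite sumEFin -EFinM lte_fin => /ltW.
split.
  rewrite (_ : (fun N => _) = EFin \o (fun N : nat =>
      N%:R^-1 * (\sum_(0 <= j < N) \int[P]_w (Z j.+1 w ^+ 2)))%R); last first.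
    apply/funext => N /=.
    have iV j : P.-integrable setT (EFin \o V j.+1) by case: (hV _ (ltn0Sn j)).
    rewrite (_ : partial_sum V N = (fun w => \sum_(0 <= j < N) V j.+1 w)%R); last first.
      by apply/funext => w; rewrite partial_sumE.
    rewrite expectation_Rintegral; last by apply: integrable_sum_real.
    rewrite Rintegral_sum// -EFinM; congr (_ * _)%R%:E; apply: eq_bigr => j _.
    (* Testing on the whole space: [V j.+1] and [Z j.+1 ^+ 2] have the same mean. *)
    case: (hV _ (ltn0Sn j)) => _ _ _ /(_ setT) h; rewrite /Rintegral h//.
    by case: hF => /(_ j)[F0 FD _] _ _; rewrite -(setD0 [set: T]); exact: FD.
  apply: cvg_EFin; first by near=> N.
  apply/cvgrPdist_le => /= e e0.
  have k0 : (0 < 1 + (C + sigma ^+ 2))%R.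
    have C0 : (0 <= C)%R.
      by apply: le_trans (hC 0%N); apply: Rintegral_ge0 => w _; exact: sqr_ge0.
    by rewrite ltr_pwDl// addr_ge0.
  have e1 : (0 < e / (1 + (C + sigma ^+ 2)))%R by rewrite divr_gt0.
  (* A single block length [K] is fixed for the tolerance first; [N] is then taken large depending
     on [K]. *)
  have [K [K0 hK2]] := filter_ex (filterI (nbhs_infty_gt 0) (L2 _ e1)).
  have hl2 := near_divn K0 (hK2 K0).
  near=> N; rewrite distrC.
  apply: le_trans (mean_bracket_bound hF hV hW hC s20 (K := K) (N := N)
    (eps := e / (1 + (C + sigma ^+ 2)))%R _ _ _) _.
  - by rewrite K0/=; near: N; exact: nbhs_infty_ge.
  - by near: N; exact: near_div_le.
  - by near: N.
  - by rewrite mulrC divfK// gt_eqF.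
move=> theta.
have main phi : (\int[P]_w cos (theta / Num.sqrt N%:R * partial_sum Z N w + phi))%R
    @[N --> \oo] --> (expR (- (sigma ^+ 2 * theta ^+ 2 / 2)) * cos phi)%R.
  set kappa := (sigma ^+ 2 ^+ 2 * theta ^+ 4 / 4 + 2 * theta ^+ 2 + `|theta| ^+ 3 * C +
    theta ^+ 2 / 2 * (1 + (sigma ^+ 2 * theta ^+ 2 / 2 + `|theta|) * (C + sigma ^+ 2) +
      2 * (1 + sigma ^+ 2) + (C + sigma ^+ 2)))%R.
  apply/cvgrPdist_le => /= e e0.
  (* The absolute value and the [+ 1] give a positive divisor without discussing the sign of
     [kappa]. *)
  have k0 : (0 < `|kappa| + 1)%R by rewrite ltr_wpDl.
  have e1 : (0 < e / (`|kappa| + 1))%R by rewrite divr_gt0.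
  have [K [K0 [hK2 hK3]]] :=
    filter_ex (filterI (nbhs_infty_gt 0) (filterI (L2 _ e1) (L3 _ e1))).
  have hl2 := near_divn K0 (hK2 K0); have hl3 := near_divn K0 hK3.
  near=> N; rewrite distrC.
  have KN : (0 < K <= N)%N by rewrite K0/=; near: N; exact: nbhs_infty_ge.
  have N0 : (0 < N)%N by case/andP: (KN); exact: leq_trans.
  apply: le_trans (characteristic_function_bound hF hZ_adapted hZ_diff hV hW hC s20
    theta phi (ltW e1) N0 KN _ _ _ _) _.
  - by near: N; exact: near_div_le.
  - by near: N; exact: L1.
  - by near: N.
  - by near: N.
  - rewrite -/kappa mulrA ler_pdivrMr// mulrC ler_wpM2l ?(ltW e0)//.
    by rewrite (le_trans (ler_norm _))// lerDl.
have mcos phi N : measurable_fun setT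
    (fun w => cos (theta / Num.sqrt N%:R * partial_sum Z N w + phi)%R).
  apply: measurableT_comp; first exact: continuous_measurable_fun (@continuous_cos R).
  apply: measurable_funD => //; apply: measurable_funM => //.
  exact: measurable_partial_sum hF hZ_adapted _.
have icos phi N : P.-integrable setT (EFin \o
    (fun w => cos (theta / Num.sqrt N%:R * partial_sum Z N w + phi)%R)).
  apply: (@le_integrable_real _ _ _ _ _ (fun=> 1%R)) => // [w|].
    exact: cos_max.
  exact: integrable_cst_prob.
have cosE N w : cos (theta * partial_sum Z N w / Num.sqrt N%:R)%R =
    cos (theta / Num.sqrt N%:R * partial_sum Z N w + 0)%R.
  by rewrite addr0 mulrAC.
have sinE N w : sin (theta * partial_sum Z N w / Num.sqrt N%:R)%R =
    cos (theta / Num.sqrt N%:R * partial_sum Z N w + - (pi / 2))%R.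
  by rewrite cosBpihalf mulrAC.
rewrite /complex_expectation /expi/=.
under eq_cvg => N.
  under [X in fine 'E_P[X] +i* _]eq_fun do rewrite cosE.
  under [X in _ +i* fine 'E_P[X]]eq_fun do rewrite sinE.
  rewrite !expectation_Rintegral//=.
  over.
apply: cvg_complex.
  by have := main 0%R; rewrite cos0 mulr1 mulNr.
(* At this phase the limit carries the factor [cos (- (pi / 2)) = 0], so the imaginary part vanishes
   in the limit. *)
by have := main (- (pi / 2))%R; rewrite cosN cos_pihalf mulr0.
Unshelve. all: by end_near. Qed.
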